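(* Let $H\leq(\mathbb Z/333\mathbb Z)^\times$ be a subgroup. If there exists an $H$-invariant Legendre pair of length $333$, then $$H\leq U_1:=\ker\left((\mathbb Z/333\mathbb Z)^\times\longrightarrow(\mathbb Z/3\mathbb Z)^\times\right)\qquad\text{and}\qquad |H|\leq 6.$$ More precisely, the group $U_1$ has exactly $30$ subgroups, exactly $19$ of which have order at least $9$; and there is a set of $21$ of these $30$ subgroups, containing all $19$ subgroups of order at least $9$, such that for every $H$ in this set no $H$-invariant Legendre pair of length $333$ exists, while the nine subgroups of $U_1$ outside this set all have order at most $6$.
   Context: Sequence indices are taken modulo the sequence length. For a real sequence $x=(x_0,\dots,x_{L-1})$, its periodic autocorrelation is $\operatorname{PAF}_x(s)=\sum_{j=0}^{L-1}x_jx_{j+s}$. For odd $L$, two sequences $a,b\in\{\pm1\}^L$ form a Legendre pair (of length $L$) if $\operatorname{PAF}_a(s)+\operatorname{PAF}_b(s)=-2$ for all $1\le s<L$. For $H\leq(\mathbb Z/L\mathbb Z)^\times$, a sequence $x$ indexed by $\mathbb Z_L$ is $H$-invariant (fixed by $H$) if $x_{hi}=x_i$ for all $h\in H$ and $i\in\mathbb Z_L$. A Legendre pair is $H$-invariant if both of its sequences are $H$-invariant. The map $(\mathbb Z/333\mathbb Z)^\times\to(\mathbb Z/3\mathbb Z)^\times$ is reduction modulo $3$. *)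

(* Defs.v *)
From HB Require Import structures.
From mathcomp Require Import all_boot all_order all_algebra all_fingroup.
From mathcomp Require Import reals.

Set Implicit Arguments.
Unset Strict Implicit.
Unset Printing Implicit Defensive.

Import GRing.Theory.
Local Open Scope ring_scope.

(* ['Z_L] is Z/LZ only when [1 < L]; the intended L is 333. *)
Section Sequences.
Variables (R : realType) (L : nat).
Implicit Types (x a b : 'Z_L -> R) (s : 'Z_L).

Definition PAF x s : R := \sum_(j : 'Z_L) x j * x (j + s).

Definition pm1_seq x : Prop := forall i, x i = 1 \/ x i = - 1.

Definition legendre_pair a b : Prop :=
  [/\ odd L, pm1_seq a, pm1_seq b
    & forall s, s != 0 -> PAF a s + PAF b s = - 2].

Definition invariant_seq (H : {group {unit 'Z_L}}) x : Prop :=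
  forall (h : {unit 'Z_L}) (i : 'Z_L), h \in H -> x (val h * i) = x i.

Definition has_invariant_legendre_pair (H : {group {unit 'Z_L}}) : Prop :=
  exists a b : 'Z_L -> R,
    [/\ legendre_pair a b, invariant_seq H a & invariant_seq H b].

End Sequences.

Arguments has_invariant_legendre_pair : clear implicits.

Lemma red_unit_proof (u : {unit 'Z_333}) :
  ((val u : nat)%:R : 'Z_3) \is a GRing.unit.
Proof.
have := valP u; rewrite -{1}(natr_Zp (val u)) /= !unitZpE //.
by apply: coprime_dvdl.
Qed.

(* Reduction modulo 3 of the representative of [u] in [0, 333). *)
Definition red (u : {unit 'Z_333}) : {unit 'Z_3} :=
  FinRing.unit 'Z_3 (red_unit_proof u).

Lemma redM : {in [set: {unit 'Z_333}] &, {morph red : u v / (u * v)%g}}.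
Proof.
move=> u v _ _; apply: val_inj => /=.
rewrite -natrM -(Zp_nat_mod (p := 3)) //.
rewrite -[RHS](Zp_nat_mod (p := 3)) //.
by congr (_%:R); apply: modn_dvdm.
Qed.

Canonical red_morphism := Morphism redM.

Definition U1 : {group {unit 'Z_333}} := ('ker red)%G.

(* Main.v *)
Require Import Defs.
From mathcomp Require Import all_boot all_order all_algebra all_fingroup.
From mathcomp Require Import cyclic finfield.
From mathcomp Require Import zify ring.
From mathcomp Require Import reals.

(* Write 333 = 9 * 37.  An invariant pair is killed by each of the following
   kinds of elements h of H, through the sums A, B of the two sequences over the
   residue classes modulo 3 or 37.
   - h = 2 mod 3: modulo 3 one gets A_1 = A_2 and B_1 = B_2, and the
     autocorrelations give (A_0 - A_1)^2 + (B_0 - B_1)^2 = 668, impossible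
     modulo 16.
   - h = (4, 1) mod (9, 37), of order 3: multiplication by h acts as translation
     by 111 on each class r mod 3 with r <> 0, up to its inverse, so both
     autocorrelations at 111 are at least 222 - 111 > 0.
   - h of order 4 modulo 37: let z be a primitive 37-th root of unity in a field
     of characteristic 167, and alpha, beta the Fourier transforms of a and b at
     z.  As -1 is in <h> modulo 37, alpha^2 + beta^2 = 668 = 4 * 167 = 0.  As
     167^9 = 6 mod 37 has order 4, alpha and beta are fixed by the 167^9-power
     Frobenius; since 167^9 = 3 mod 4, -1 is not a square among fixed elements,
     so alpha = beta = 0.  Hence the class sums modulo 37 all agree modulo 167,
     which contradicts a total of 1 or -1.
   - h = 1 mod 3 of order 9 modulo 37: the orbits of h off the multiples of 37
     have 9 elements, so the class sums modulo 3 are c_r + 18 t_r with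
     |c_r| <= 3.  The total 1 or -1 forces the t_r to add up to 0, so either all
     squares A_r^2 are at most 9 or two of them are at least 15^2; but the six
     squares for a and b add up to 446 < 450.
   Every subgroup of U1 = <x> * <y>, with x = (1, 2) and y = (4, 1), that is of
   order at least 9 contains x^9, y or some x^4 y^j. *)

Set Implicit Arguments.
Unset Strict Implicit.
Unset Printing Implicit Defensive.

Import Order.TTheory GRing.Theory Num.Theory.
Local Open Scope ring_scope.

(** * Integral Legendre pairs and class sums *)

(** Integer values can be mapped into any commutative ring, in particular into a field of
    characteristic 167. *)
Definition int_pair (a b : 'Z_333 -> int) : Prop :=
  [/\ forall i, a i = 1 \/ a i = -1, forall i, b i = 1 \/ b i = -1
    & forall s, s != 0 ->
      \sum_j a j * a (j + s) + \sum_j b j * b (j + s) = -2].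

Lemma int_pairC a b : int_pair a b -> int_pair b a.
Proof. by case=> ha hb hab; split=> // s /hab; rewrite addrC. Qed.

Lemma pm1_lift (R : realType) (x : 'Z_333 -> R) :
  pm1_seq x -> exists2 a : 'Z_333 -> int,
    forall i, a i = 1 \/ a i = -1 & forall i, x i = (a i)%:~R.
Proof.
move=> hx; exists (fun i => if x i == 1 then 1 else -1) => i.
  by case: ifP; [left | right].
by case: eqP => [-> //|]; case: (hx i) => -> // _; rewrite ?rmorphN.
Qed.

Lemma invariant_int_pair (R : realType) (H : {group {unit 'Z_333}}) :
  has_invariant_legendre_pair R 333 H ->
  exists a b, [/\ int_pair a b,
    {in H, forall h i, a (val h * i) = a i}
  & {in H, forall h i, b (val h * i) = b i}].
Proof.
case=> x [y [[_ hx hy hxy] ix iy]].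
case: (pm1_lift hx) => a ha xa; case: (pm1_lift hy) => b hb yb.
exists a, b; split.
- split=> // s s0; apply: (@intr_inj R); move: (hxy s s0).
  rewrite /PAF rmorphD !rmorph_sum rmorphN /=.
  under eq_bigr do rewrite !xa -rmorphM.
  by under [X in _ + X]eq_bigr do rewrite !yb -rmorphM.
- by move=> h hH i; apply: (@intr_inj R); rewrite -!xa ix.
- by move=> h hH i; apply: (@intr_inj R); rewrite -!yb iy.
Qed.

(** Both sides run over pairs of positions; the left one groups them by their difference
    [s = j - i]. *)
Lemma sum_weighted_corr (V : finZmodType) (K : comPzRingType) (g w : V -> K) :
  \sum_s w s * (\sum_j g j * g (j + s)) =
  \sum_i g i * (\sum_j g j * w (j - i)).
Proof.
under eq_bigr do rewrite mulr_sumr.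
rewrite exchange_big; apply: eq_bigr => i _ /=.
rewrite mulr_sumr [LHS](reindex_inj (addIr (- i))) /=.
by apply: eq_bigr => j _; rewrite [i + _]addrC subrK mulrC -mulrA.
Qed.

(** The two autocorrelations add up to 666 at 0 and to -2 elsewhere, that is to 668 times the delta
    at 0, minus 2. The weights used below are 1, the indicator of the multiples of 3, and
    [u ^+ s]. *)
Lemma int_pair_weighted (K : comNzRingType) (w : 'Z_333 -> K) a b :
  int_pair a b ->
  \sum_i (a i)%:~R * (\sum_j (a j)%:~R * w (j - i)) +
  \sum_i (b i)%:~R * (\sum_j (b j)%:~R * w (j - i)) =
  668%:R * w 0 - 2%:R * \sum_s w s.
Proof.
case=> ha hb hab.
rewrite -(sum_weighted_corr (fun i => (a i)%:~R)).
rewrite -(sum_weighted_corr (fun i => (b i)%:~R)) -big_split /=.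
have sq (c : 'Z_333 -> int) : (forall i, c i = 1 \/ c i = -1) ->
    \sum_j c j * c (j + 0) = 333%:R.
  move=> hc; rewrite (eq_bigr (fun=> 1)); last first.
    by move=> i _; rewrite addr0; case: (hc i) => ->.
  by rewrite sumr_const card_ord.
under eq_bigr => s _.
  rewrite -mulrDr; under eq_bigr do rewrite -rmorphM.
  under [X in _ * (_ + X)]eq_bigr do rewrite -rmorphM.
  rewrite -!rmorph_sum -rmorphD; over.
rewrite [in RHS](bigD1 0) // [in LHS](bigD1 0) //= !sq //.
rewrite (eq_bigr (fun s => - 2%:R * w s)); last first.
  by move=> s s0; rewrite hab // mulrC.
by rewrite -mulr_sumr; ring.
Qed.

Lemma int_pair_total a b : int_pair a b ->
  (\sum_i a i == 1) || (\sum_i a i == -1).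
Proof.
move=> hab; have := int_pair_weighted (fun=> 1 : int) hab.
have sq (c : 'Z_333 -> int) :
    \sum_i (c i)%:~R * (\sum_j (c j)%:~R * 1) = (\sum_i c i) * (\sum_i c i) :> int.
  rewrite mulr_suml; apply: eq_bigr => i _; rewrite intz; congr (_ * _).
  by apply: eq_bigr => j _; rewrite mulr1 intz.
rewrite !sq sumr_const card_ord.
move: (\sum_i a i) (\sum_i b i) => s t e.
have {}e : s * s + t * t = 2 by rewrite e.
have [s1 s2] : s <= 1 /\ -1 <= s by split; nia.
have [t1 t2] : t <= 1 /\ -1 <= t by split; nia.
have [s0|s0] : s = 0 \/ s <> 0 by lia.
  move: e; rewrite s0 mul0r add0r.
  by have [->|[->|->]] : t = 0 \/ t = 1 \/ t = -1 by lia.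
by lia.
Qed.

Definition cls (M : nat) (i : 'Z_333) : nat := (i %% M)%N.

Definition class_sum (M r : nat) (a : 'Z_333 -> int) :=
  \sum_(i : 'Z_333 | cls M i == r) a i.

Lemma sum_classes (V : nmodType) (M : nat) (F : 'Z_333 -> V) : (0 < M)%N ->
  \sum_i F i = \sum_(r < M) \sum_(i : 'Z_333 | cls M i == r) F i.
Proof.
move=> M0.
by rewrite (partition_big (fun i : 'Z_333 => Ordinal (ltn_pmod i M0)) predT).
Qed.

Lemma cls_sub_eq0 (M : nat) (i j : 'Z_333) : (M %| 333)%N ->
  (cls M (j - i) == 0%N) = (cls M j == cls M i).
Proof.
move=> M333; rewrite -[j in RHS](subrK i); move: (j - i) => k.
by rewrite /cls /= modn_dvdm // -[X in _ == (X %% M)%N]add0n eqn_modDr mod0n.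
Qed.

(** The weight is the indicator of the multiples of 3, and 446 = 668 - 2 * 111. *)
Lemma class_sum3_squares a b : int_pair a b ->
  class_sum 3 0 a ^+ 2 + class_sum 3 1 a ^+ 2 + class_sum 3 2 a ^+ 2 +
  (class_sum 3 0 b ^+ 2 + class_sum 3 1 b ^+ 2 + class_sum 3 2 b ^+ 2) = 446.
Proof.
move=> hab; have := int_pair_weighted (fun s => (cls 3 s == 0%N)%:R : int) hab.
have -> : \sum_s (cls 3 s == 0%N)%:R = 111 :> int.
  transitivity (\sum_(0 <= s < 333) (s %% 3 == 0)%N%:R : int).
    by rewrite big_mkord.
  by rewrite unlock; vm_compute.
have sq (c : 'Z_333 -> int) :
    \sum_i (c i)%:~R * (\sum_j (c j)%:~R * (cls 3 (j - i) == 0%N)%:R) =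
    class_sum 3 0 c ^+ 2 + class_sum 3 1 c ^+ 2 + class_sum 3 2 c ^+ 2.
  transitivity (\sum_i c i * class_sum 3 (cls 3 i) c).
    apply: eq_bigr => i _; rewrite intz; congr (_ * _).
    rewrite /class_sum [RHS]big_mkcond; apply: eq_bigr => j _ /=.
    by rewrite cls_sub_eq0 // intz; case: ifP; rewrite ?mulr1 ?mulr0.
  rewrite (sum_classes (M := 3)) // !big_ord_recl big_ord0 /= addr0 addrA.
  by congr (_ + _ + _); rewrite expr2 {1}/class_sum mulr_suml;
    apply: eq_bigr => i /eqP ->.
by rewrite !sq.
Qed.

Lemma class_sum3_total a :
  \sum_i a i = class_sum 3 0 a + class_sum 3 1 a + class_sum 3 2 a.
Proof. by rewrite (sum_classes (M := 3)) // !big_ord_recl big_ord0 addr0 addrA. Qed.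

Lemma clsM (M : nat) (i j : 'Z_333) : (M %| 333)%N ->
  cls M (i * j) = (cls M i * cls M j %% M)%N.
Proof. by move=> M333; rewrite /cls /= modn_dvdm // modnMml modnMmr. Qed.

Lemma clsX (M : nat) (i : 'Z_333) n : (1 < M)%N -> (M %| 333)%N ->
  cls M (i ^+ n) = (cls M i ^ n %% M)%N.
Proof.
move=> M1 M333; elim: n => [|n IHn]; first by rewrite /cls expr0 modn_small.
by rewrite exprS clsM // IHn expnS modnMmr.
Qed.

(** Reducing after every multiplication keeps the unary numbers small enough for evaluation. *)
Lemma expn_mod_iter (g M n : nat) : (1 < M)%N ->
  (g ^ n %% M = iter n (fun m => g * m %% M) 1)%N.
Proof.
move=> M1; elim: n => [|n IHn]; first by rewrite modn_small.
by rewrite iterS -IHn expnS modnMmr.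
Qed.

Lemma sum_clsE (V : nmodType) (F : nat -> V) :
  \sum_(i : 'Z_333) F i = \sum_(0 <= i < 333) F i.
Proof. by rewrite big_mkord. Qed.

Lemma eq_natrZ (m n : nat) : (m %% 333 = n %% 333)%N -> m%:R = n%:R :> 'Z_333.
Proof. by move=> e; rewrite -(Zp_nat_mod (isT : 1 < 333)%N m) e Zp_nat_mod. Qed.

(** * Obstructions over the integers *)

Lemma sum_two_squares_neq668 (x y : int) : x ^+ 2 + y ^+ 2 <> 668.
Proof.
(* Two such squares never add up to 12 modulo 16, the residue of 668. *)
have sq (z : int) : exists k,
    [\/ z ^+ 2 = 16 * k, z ^+ 2 = 16 * k + 4 | z ^+ 2 = 8 * k + 1].
  have [k [r [-> r0 r4]]] : exists k r : int, [/\ z = 4 * k + r, 0 <= r & r < 4].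
    by exists (z %/ 4)%Z, (z %% 4)%Z; split; lia.
  have [->|[->|[->|->]]] : r = 0 \/ r = 1 \/ r = 2 \/ r = 3 by lia.
  - by exists (k ^+ 2); constructor 1; ring.
  - by exists (2 * k ^+ 2 + k); constructor 3; ring.
  - by exists (k ^+ 2 + k); constructor 2; ring.
  - by exists (2 * k ^+ 2 + 3 * k + 1); constructor 3; ring.
by have [k [->|->|->]] := sq x; have [l [->|->|->]] := sq y; lia.
Qed.

Lemma int_pair_not2_mod3 a b (h : {unit 'Z_333}) : int_pair a b ->
  (forall i, a (val h * i) = a i) -> (forall i, b (val h * i) = b i) ->
  cls 3 (val h) <> 2%N.
Proof.
move=> hab ha hb h2.
have e12 (c : 'Z_333 -> int) : (forall i, c (val h * i) = c i) ->
    class_sum 3 1 c = class_sum 3 2 c.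
  move=> hc; rewrite /class_sum [RHS](reindex_inj (mulrI (valP h))) /=.
  apply: eq_big => [i|i _]; last by rewrite hc.
  by rewrite clsM // h2 /cls; lia.
have := class_sum3_squares hab; have := int_pair_total hab.
have := int_pair_total (int_pairC hab).
rewrite !class_sum3_total (e12 a) // (e12 b) //.
move: (class_sum 3 0 a) (class_sum 3 2 a) (class_sum 3 0 b) (class_sum 3 2 b).
(* Since [3 (p^2 + 2 q^2) = (p + 2 q)^2 + 2 (p - q)^2], and likewise for [r] and [s], totals of 1 or
   -1 turn 3 * 446 into 2 + 2 * 668. *)
move=> p q r s e1 e2 e3; apply: (@sum_two_squares_neq668 (p - q) (r - s)).
nia.
Qed.

Lemma int_pair_not112 a b (h : {unit 'Z_333}) : int_pair a b ->
  (forall i, a (val h * i) = a i) -> (forall i, b (val h * i) = b i) ->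
  val h <> 112%:R.
Proof.
move=> hab ha hb eh.
have lb (c : 'Z_333 -> int) : (forall i, c i = 1 \/ c i = -1) ->
    (forall i, c (val h * i) = c i) -> 111 <= \sum_j c j * c (j + 111%:R).
  move=> c1 hc.
  apply: (@le_trans _ _ (\sum_(j : 'Z_333) (if (j %% 3 == 0)%N then -1 else 1))).
    rewrite (sum_clsE (fun j => if (j %% 3 == 0)%N then -1 else 1)) unlock.
    by vm_compute.
  apply: ler_sum => j _; case: ifP => j3.
    by case: (c1 j) => ->; case: (c1 (j + 111%:R)) => ->.
  have -> : c (j + 111%:R) = c j; last by case: (c1 j) => ->.
  (* As [112 j = j + 111 j], multiplication by [h] adds 111 if j = 1 modulo 3. If j = 2 it adds 222,
     and doing it twice adds 444 = 111. *)
  have [j1|j2] : (j %% 3 = 1 \/ j %% 3 = 2)%N by lia.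
    rewrite -[RHS]hc eh -(natr_Zp j) -natrM -natrD.
    by congr (c _); apply: eq_natrZ; lia.
  rewrite -[RHS]hc -[RHS]hc eh -(natr_Zp j) -!natrM -natrD.
  by congr (c _); apply: eq_natrZ; lia.
case: (hab) => a1 b1 /(_ 111%:R isT) e.
by have := lb a a1 ha; have := lb b b1 hb; lia.
Qed.

(** [D] is a union of orbits of multiplication by [h]. Each has 9 elements, because 16 has order 9
    modulo 37 and the members of [D] are invertible there. *)
Lemma dvdn9_card_stable (h : {unit 'Z_333}) (D : {pred 'Z_333}) :
  val h ^+ 9 = 1 -> cls 37 (val h) = 16%N ->
  (forall i, (val h * i \in D) = (i \in D)) ->
  (forall i, i \in D -> cls 37 i != 0%N) -> (9 %| #|D|)%N.
Proof.
move=> h9 h37 hD D37; set f := fun i : 'Z_333 => val h * i.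
have injf : injective f := mulrI (valP h).
have iterf n i : iter n f i = val h ^+ n * i.
  by elim: n => [|n IHn]; rewrite ?mul1r // iterS IHn /f mulrA -exprS.
rewrite -(@fcard_order_set _ f injf 9 D) ?dvdn_mull //; last first.
  by apply: intro_closed => [|i j /eqP <-]; rewrite ?hD //; apply: fconnect_sym.
apply/subsetP => i iD; rewrite inE.
have le9 : (fingraph.order f i <= 9)%N.
  (* In a longer cycle the ninth iterate of [i] would have index 9, but it is [i] itself, of index
     0. *)
  rewrite leqNgt; apply/negP => /findex_iter; rewrite iterf h9 mul1r.
  by rewrite findex0.
have := iter_order injf i; rewrite iterf => /(congr1 (cls 37)).
rewrite clsM // clsX // h37 expn_mod_iter //.
have : (cls 37 i < 37)%N by rewrite ltn_mod.
have := fingraph.order_gt0 f i; move: (fingraph.order f i) le9 (cls 37 i) (D37 i iD).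
move=> n n9 c c0 n0 c37 e.
have /allP/(_ n)/[!mem_iota]/(_ _)/allP/(_ c)/[!mem_iota] : all (fun n => all (fun c =>
    (iter n (fun m => 16 * m %% 37) 1 * c %% 37 == c) ==> (n == 9))%N
    (iota 1 36)) (iota 1 9) by vm_compute.
rewrite e eqxx; apply; first by rewrite n0.
by rewrite lt0n c0.
Qed.

(** A class has 111 elements. Its 3 multiples of 37 contribute [c]; among the other 108 the number
    of entries -1 is some [9 m], so they contribute [108 - 18 m = 18 (6 - m)]. *)
Lemma class_sum_mod18 a (h : {unit 'Z_333}) r : (r < 3)%N ->
  (forall i, a i = 1 \/ a i = -1) -> (forall i, a (val h * i) = a i) ->
  val h ^+ 9 = 1 -> cls 37 (val h) = 16%N -> cls 3 (val h) = 1%N ->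
  exists c t : int, [/\ -3 <= c, c <= 3 & class_sum 3 r a = c + 18 * t].
Proof.
move=> r3 a1 ha h9 h37 h3.
pose D := [pred i | [&& a i == -1, cls 3 i == r & cls 37 i != 0%N]].
have D9 : (9 %| #|D|)%N.
  apply: (dvdn9_card_stable h9 h37) => [i|i /and3P[]//].
  rewrite !inE ha !clsM // h3 h37 mul1n modn_mod; congr [&& _, _ & _].
  have : (cls 37 i < 37)%N by rewrite ltn_mod.
  by move: (cls 37 i) => k k37; lia.
pose c : int := \sum_(i | (cls 3 i == r) && (cls 37 i == 0%N)) a i.
have c3 : `|c| <= 3.
  apply: (le_trans (ler_norm_sum _ _ _)).
  rewrite (eq_bigr (fun=> 1)); last by move=> i _; case: (a1 i) => ->.
  rewrite big_mkcond (sum_clsE (fun i =>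
    if (i %% 3 == r)%N && (i %% 37 == 0)%N then 1 else 0)).
  by case: r r3 {D D9 c} => [|[|[|//]]] _; rewrite unlock; vm_compute.
exists c, (6 - (#|D| %/ 9)%:Z); split; [lia|lia|].
rewrite /class_sum (bigID (fun i => cls 37 i == 0%N)) /= -/c; congr (_ + _).
rewrite (eq_bigr (fun i => 1 - 2 * (if a i == -1 then 1 else 0))); last first.
  by move=> i _; case: (a1 i) => ->.
rewrite sumrB -mulr_sumr -big_mkcondr /=.
have -> : \sum_(i | (cls 3 i == r) && (cls 37 i != 0%N)) 1 = 108 :> int.
  rewrite big_mkcond (sum_clsE (fun i =>
    if (i %% 3 == r)%N && (i %% 37 != 0)%N then 1 else 0)).
  by case: r r3 {D D9 c c3} => [|[|[|//]]] _; rewrite unlock; vm_compute.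
have -> : \sum_(i | (cls 3 i == r) && (cls 37 i != 0%N) && (a i == -1)) 1 = #|D|%:Z.
  rewrite -sum1_card (big_morph Posz PoszD (erefl _)).
  by apply: eq_bigl => i; rewrite inE andbC andbA.
rewrite -{2}(divnK D9); lia.
Qed.

Lemma sqr_mod18_gap (c0 c1 c2 t0 t1 t2 : int) :
  -3 <= c0 <= 3 -> -3 <= c1 <= 3 -> -3 <= c2 <= 3 ->
  let: (x0, x1, x2) := (c0 + 18 * t0, c1 + 18 * t1, c2 + 18 * t2) in
  x0 + x1 + x2 = 1 \/ x0 + x1 + x2 = -1 ->
  let s := x0 ^+ 2 + x1 ^+ 2 + x2 ^+ 2 in 0 <= s <= 27 \/ 450 <= s.
Proof.
move=> b0 b1 b2 e; have t012 : t0 + t1 + t2 = 0 by lia.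
have sq (c t : int) : -3 <= c <= 3 ->
    [/\ t = 0 & 0 <= (c + 18 * t) ^+ 2 <= 9] \/
    [/\ t <> 0 & 225 <= (c + 18 * t) ^+ 2].
  move=> bc; have [->|tn0] : t = 0 \/ t <> 0 by lia.
    by left; split=> //; rewrite mulr0 addr0; nia.
  right; split=> //.
  have [h|h] : 15 <= c + 18 * t \/ c + 18 * t <= -15 by lia.
    by move: (c + 18 * t) h => z h; nia.
  by move: (c + 18 * t) h => z h; nia.
have := sq _ t0 b0; have := sq _ t1 b1; have := sq _ t2 b2.
move: ((c0 + 18 * t0) ^+ 2) ((c1 + 18 * t1) ^+ 2) ((c2 + 18 * t2) ^+ 2).
by move=> x0 x1 x2 [[? ?]|[? ?]] [[? ?]|[? ?]] [[? ?]|[? ?]]; lia.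
Qed.

Lemma int_pair_not_order9 a b (h : {unit 'Z_333}) : int_pair a b ->
  (forall i, a (val h * i) = a i) -> (forall i, b (val h * i) = b i) ->
  val h ^+ 9 = 1 -> cls 37 (val h) = 16%N -> cls 3 (val h) <> 1%N.
Proof.
move=> hab ha hb h9 h37 h3; case: (hab) => a1 b1 _.
have dec (x : 'Z_333 -> int) : (forall i, x i = 1 \/ x i = -1) ->
    (forall i, x (val h * i) = x i) -> \sum_i x i = 1 \/ \sum_i x i = -1 ->
  let s := class_sum 3 0 x ^+ 2 + class_sum 3 1 x ^+ 2 + class_sum 3 2 x ^+ 2 in
  0 <= s <= 27 \/ 450 <= s.
  move=> x1 hx; rewrite class_sum3_total.
  have [c0 [t0 [l0 u0 ->]]] := class_sum_mod18 (isT : 0 < 3)%N x1 hx h9 h37 h3.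
  have [c1 [t1 [l1 u1 ->]]] := class_sum_mod18 (isT : 1 < 3)%N x1 hx h9 h37 h3.
  have [c2 [t2 [l2 u2 ->]]] := class_sum_mod18 (isT : 2 < 3)%N x1 hx h9 h37 h3.
  by apply: sqr_mod18_gap; apply/andP.
have := dec a a1 ha; have := dec b b1 hb.
have := class_sum3_squares hab; have := int_pair_total hab.
have := int_pair_total (int_pairC hab).
lia.
Qed.

(** * Fourier transforms in characteristic 167 *)

Lemma finField_prim_root (F : finFieldType) n :
  (n %| #|F|.-1)%N -> exists z : F, n.-primitive_root z.
Proof.
have card_gt1 := finNzRing_gt1 F.
pose rs := enum (predC1 (0 : F)).
have rs_unity : all #|F|.-1.-unity_root rs.
  apply/allP => x; rewrite mem_enum => x0.
  rewrite unity_rootE -(inj_eq (mulfI x0)) -exprS prednK ?mulr1 ?expf_card //.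
  exact: ltnW.
have rs_size : (#|F|.-1 <= size rs)%N by rewrite -cardE cardC1.
have F0 : (0 < #|F|.-1)%N by rewrite -ltnS prednK // ltnW.
have /hasP[z _ zP] := has_prim_root F0 rs_unity (enum_uniq _) rs_size.
by move=> nF; exists (z ^+ (#|F|.-1 %/ n)); apply: dvdn_prim_root.
Qed.

(** The field with [p ^ totient n] elements works: by Euler's theorem [n] divides the order of its
    multiplicative group. *)
Lemma prim_root_pchar (p n : nat) : prime p -> coprime p n -> (0 < n)%N ->
  exists (F : finFieldType) (z : F), p \in [pchar F] /\ n.-primitive_root z.
Proof.
move=> p_pr pn n0.
have k0 : (0 < totient n)%N by rewrite totient_gt0.
have [F pF cardF] := pPrimePowerField p_pr k0.
have [|z zP] := @finField_prim_root F n; last by exists F, z.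
have := Euler_exp_totient pn; rewrite cardF => /eqP.
by rewrite eqn_mod_dvd ?expn_gt0 ?prime_gt0 // subn1.
Qed.

Lemma root1_neq0 (F : fieldType) (u : F) n : u ^+ n.+1 = 1 -> u != 0.
Proof.
by move=> un; apply/eqP => u0; move/eqP: un; rewrite u0 expr0n eq_sym oner_eq0.
Qed.

(** Otherwise [v = t / s] satisfies [v^2 = -1] and [v^q = v], whereas q = 3 modulo 4 gives
    [v^q = v^3 = -v]. *)
Lemma sqr_add_eq0_frobenius_fixed (F : fieldType) (q : nat) (s t : F) :
  2%:R != 0 :> F -> (q %% 4 = 3)%N -> s ^+ q = s -> t ^+ q = t ->
  s ^+ 2 + t ^+ 2 = 0 -> s = 0.
Proof.
move=> two q3 sq tq st; apply/eqP/negPn/negP => s0.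
pose v := t / s.
have v2 : v ^+ 2 = -1.
  rewrite /v expr_div_n; apply/eqP; rewrite -subr_eq0 opprK.
  by rewrite -[1](@divff _ (s ^+ 2)) ?expf_neq0 // -mulrDl addrC st mul0r.
have vq : v ^+ q = v by rewrite expr_div_n sq tq.
have : v ^+ q = - v.
  rewrite (divn_eq q 4) q3 exprD mulnC exprM.
  by rewrite (exprM v 2 2) v2 sqrrN !expr1n mul1r exprSr v2 mulN1r.
rewrite vq => /eqP; rewrite -subr_eq0 opprK -mulr2n -mulr_natr mulf_eq0.
rewrite (negbTE two) orbF => /eqP v0; move: v2; rewrite v0 expr0n /= => /eqP.
by rewrite eq_sym oppr_eq0 oner_eq0.
Qed.

(** The exponent is the representative of [i] in [0, 333), so [u ^+ i] is a character of Z/333 once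
    [u ^+ 333 = 1], as for 37-th roots of unity. *)
Definition dft (F : fieldType) (u : F) (a : 'Z_333 -> int) : F :=
  \sum_(i : 'Z_333) (a i)%:~R * u ^+ i.

Lemma dft1 (F : fieldType) a : dft (1 : F) a = (\sum_i a i)%:~R.
Proof. by rewrite rmorph_sum; apply: eq_bigr => i _; rewrite expr1n mulr1. Qed.

Lemma dft_mult (F : fieldType) (u : F) a (h : {unit 'Z_333}) : u ^+ 37 = 1 ->
  (forall i, a (val h * i) = a i) -> dft (u ^+ cls 37 (val h)) a = dft u a.
Proof.
move=> u37 ha; rewrite /dft [RHS](reindex_inj (mulrI (valP h))) /=.
apply: eq_bigr => i _; rewrite ha -exprM; congr (_ * _).
by rewrite -(expr_mod _ u37) -[RHS](expr_mod _ u37) /cls modnMml modn_dvdm.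
Qed.

(** The weight [u ^+ s] sums to 0, being a geometric series with ratio [u <> 1] and
    [u ^+ 333 = 1]. *)
Lemma dft_sqr_sum (F : fieldType) (u : F) a b : int_pair a b ->
  u ^+ 37 = 1 -> u != 1 ->
  dft u^-1 a * dft u a + dft u^-1 b * dft u b = 668%:R.
Proof.
move=> hab u37 u1.
have u0 : u != 0 := root1_neq0 u37.
have := int_pair_weighted (fun s : 'Z_333 => u ^+ s) hab.
have -> : \sum_(s : 'Z_333) u ^+ s = 0.
  have := subrX1 u 333; rewrite (exprM u 37 9) u37 expr1n subrr => /eqP.
  by rewrite eq_sym mulf_eq0 subr_eq0 (negbTE u1) => /eqP.
rewrite mulr0 subr0 mulr1 => <-.
have dd (c : 'Z_333 -> int) : dft u^-1 c * dft u c =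
    \sum_i (c i)%:~R * (\sum_j (c j)%:~R * u ^+ (j - i : 'Z_333)%R).
  rewrite /dft mulr_suml; apply: eq_bigr => i _; rewrite -mulrA; congr (_ * _).
  rewrite mulr_sumr; apply: eq_bigr => j _; rewrite mulrCA; congr (_ * _).
  rewrite -[in LHS](subrK i j); move: (j - i) => k.
  rewrite -(expr_mod _ u37) /= modn_dvdm // expr_mod // exprD exprVn.
  by rewrite mulrCA mulVf ?mulr1 // expf_neq0.
by rewrite !dd.
Qed.

Lemma expf_sum_pchar (F : fieldType) (I : finType) (f : I -> F) q :
  [pchar F].-nat q -> (\sum_i f i) ^+ q = \sum_i f i ^+ q.
Proof.
move=> hq; have q0 : (0 < q)%N by case/andP: hq.
apply: (big_morph (fun x => x ^+ q)); first by move=> x y; apply: exprDn_pchar.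
by rewrite expr0n; case: q q0 {hq}.
Qed.

Lemma dft_frobenius (F : fieldType) (u : F) a q : odd q ->
  [pchar F].-nat q -> (forall i, a i = 1 \/ a i = -1) ->
  dft u a ^+ q = dft (u ^+ q) a.
Proof.
move=> oq hq a1; rewrite /dft expf_sum_pchar //; apply: eq_bigr => i _.
rewrite exprMn exprAC; congr (_ * _).
by case: (a1 i) => ->; rewrite ?rmorphN rmorph1 ?expr1n // -signr_odd oq.
Qed.

Lemma dft_eq0 (F : fieldType) (u : F) a b (h : {unit 'Z_333}) : int_pair a b ->
  167 \in [pchar F] -> u ^+ 37 = 1 -> u != 1 ->
  (forall i, a (val h * i) = a i) -> (forall i, b (val h * i) = b i) ->
  cls 37 (val h) = 6%N -> dft u a = 0.
Proof.
move=> hab F167 u37 u1 ha hb h6; case: (hab) => a1 b1 _.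
have [q [q37 q4 q1 hq]] : exists q,
    [/\ (q %% 37 = 6)%N, (q %% 4 = 3)%N, odd q & [pchar F].-nat q].
  (* Modulo 37, 167^3 = 14 and 14^3 = 6, so the power [q] acts on [u] as [h] does. The exponent 9 is
     odd, so q = 3 modulo 4 like 167. *)
  exists (167 ^ 9)%N; split; last by rewrite pnatX pnatE ?F167.
  - by rewrite -modnXm (expnM _ 3 3) -modnXm.
  - by rewrite -modnXm.
  - by rewrite oddX.
have uq : u ^+ q = u ^+ cls 37 (val h) by rewrite -(expr_mod _ u37) q37 h6.
have u0 : u != 0 := root1_neq0 u37.
have uV : u ^+ 36 = u^-1 by apply: (mulfI u0); rewrite -exprS u37 divff.
(* As 36 = -1 modulo 37, acting twice by [h] inverts [u]. *)
have h36 : (cls 37 (val h) * cls 37 (val h))%N = 36%N by rewrite h6.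
have conj (c : 'Z_333 -> int) : (forall i, c (val h * i) = c i) ->
    dft u^-1 c = dft u c.
  move=> hc; rewrite -uV -[X in u ^+ X]h36 exprM.
  have uh37 : (u ^+ cls 37 (val h)) ^+ 37 = 1 by rewrite exprAC u37 expr1n.
  by rewrite (dft_mult uh37 hc) (dft_mult u37 hc).
have two : 2%:R != 0 :> F by rewrite -(dvdn_pcharf F167).
have sq := dft_sqr_sum hab u37 u1.
rewrite (conj a ha) (conj b hb) -!expr2 (natrM _ 4 167) (pcharf0 F167) mulr0 in sq.
apply: (sqr_add_eq0_frobenius_fixed two q4 _ _ sq).
  by rewrite (dft_frobenius _ q1 hq a1) uq (dft_mult u37 ha).
by rewrite (dft_frobenius _ q1 hq b1) uq (dft_mult u37 hb).
Qed.

(** Fourier inversion modulo 37: the powers [v ^+ k] of [v = z ^+ i / z ^+ r] add up to 37 if i = r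
    modulo 37, and to 0 otherwise. *)
Lemma dft_inversion (F : fieldType) (z : F) a r : 37.-primitive_root z ->
  (r < 37)%N ->
  \sum_(k < 37) dft (z ^+ k) a * (z ^+ k) ^- r = 37%:R * (class_sum 37 r a)%:~R.
Proof.
move=> zP r37; rewrite /dft.
under eq_bigr do rewrite mulr_suml.
rewrite exchange_big /= /class_sum rmorph_sum mulr_sumr [RHS]big_mkcond /=.
apply: eq_bigr => i _.
pose v := z ^+ i / z ^+ r.
transitivity ((a i)%:~R * \sum_(k < 37) v ^+ k).
  rewrite mulr_sumr; apply: eq_bigr => k _; rewrite -mulrA; congr (_ * _).
  by rewrite /v expr_div_n -!exprM mulnC (mulnC r).
have z37 := prim_expr_order zP.
have zr0 : z ^+ r != 0 by rewrite expf_neq0 ?(root1_neq0 z37).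
case: eqP => ir.
  have -> : v = 1.
    by rewrite /v -(expr_mod _ z37) -/(cls 37 i) ir divff.
  under eq_bigr do rewrite expr1n.
  by rewrite sumr_const card_ord mulrC.
have v1 : v != 1.
  apply/eqP => /(canRL (mulfVK zr0)) /eqP; rewrite mul1r (eq_prim_root_expr zP).
  by rewrite (modn_small r37) => /eqP.
have : v ^+ 37 - 1 = 0.
  by rewrite expr_div_n -!exprM !(mulnC _ 37) !exprM z37 !expr1n divr1 subrr.
rewrite subrX1 => /eqP; rewrite mulf_eq0 subr_eq0 (negbTE v1) => /eqP ->.
by rewrite mulr0.
Qed.

Lemma int_pair_not6_mod37 a b (h : {unit 'Z_333}) : int_pair a b ->
  (forall i, a (val h * i) = a i) -> (forall i, b (val h * i) = b i) ->
  cls 37 (val h) <> 6%N.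
Proof.
move=> hab ha hb h6; case: (hab) => a1 _ _.
have [|||F [z [F167 zP]]] := @prim_root_pchar 167 37; [by []|by []|by []|].
have z37 := prim_expr_order zP.
have cong r : (r < 37)%N ->
    (167 %| 37 * class_sum 37 r a - \sum_i a i)%Z.
  move=> r37; rewrite (dvdz_pcharf F167); apply/eqP.
   rewrite rmorphB rmorphM /= -(dft_inversion a zP r37) big_ord_recl.
  rewrite big1 => [|k _]; last first.
    have zk37 : (z ^+ lift ord0 k) ^+ 37 = 1 by rewrite exprAC z37 expr1n.
    have zk1 : z ^+ lift ord0 k != 1.
      by rewrite -(prim_order_dvd zP) gtnNdvd // ltn_ord.
    by rewrite (dft_eq0 hab F167 zk37 zk1 ha hb h6) mul0r.
  by rewrite addr0 expr0 expr1n invr1 mulr1 dft1 subrr.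
have bound r : (r < 37)%N -> `|class_sum 37 r a| <= 9.
  move=> r37; apply: (le_trans (ler_norm_sum _ _ _)).
  rewrite (eq_bigr (fun=> 1)); last by move=> i _; case: (a1 i) => ->.
  rewrite big_mkcond (sum_clsE (fun i => if (i %% 37 == r)%N then 1 else 0)).
  have /allP : all (fun r =>
      \sum_(0 <= i < 333) (if (i %% 37 == r)%N then 1 else 0) <= 9 :> int)
    (iota 0 37).
    by rewrite unlock; vm_compute.
  by apply; rewrite mem_iota.
have s1 := int_pair_total hab.
(* Since 37 * 9 = -1 modulo 167, the class sum is -9 times the total modulo 167; both sides are at
   most 9 in absolute value, hence equal. *)
have cls9 r : (r < 37)%N -> class_sum 37 r a = - 9 * \sum_i a i.
  move=> r37; move: (bound r r37) (cong r r37) s1.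
  by move: (class_sum _ _ _) (\sum_i _) => x s; lia.
(* Adding up the classes makes the total -333 times itself, hence 0. *)
have : \sum_i a i = \sum_(r < 37) (- 9 * \sum_i a i).
  rewrite {1}(sum_classes a (isT : 0 < 37)%N).
  by apply: eq_bigr => r _; apply: cls9 (ltn_ord r).
by rewrite sumr_const card_ord; move: s1; lia.
Qed.

(** * The subgroups of U1 *)

Local Close Scope ring_scope.

Definition unitZ333 (n : nat) (co : coprime 333 n) : {unit 'Z_333} :=
  FinRing.Unit (etrans (unitZpE n (isT : 1 < 333)) co).

Lemma val_unitZ333 n (co : coprime 333 n) : val (unitZ333 co) = (n%:R)%R.
Proof. by []. Qed.

(* gx = (1, 2) and gy = (4, 1) modulo (9, 37), of orders 36 and 3. *)
Definition gx : {unit 'Z_333} := unitZ333 (isT : coprime 333 298).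
Definition gy : {unit 'Z_333} := unitZ333 (isT : coprime 333 112).
Definition gxy (i j : nat) : {unit 'Z_333} := (gx ^+ i * gy ^+ j)%g.

Lemma gxyM i j k l : (gxy i j * gxy k l)%g = gxy (i + k) (j + l).
Proof.
have cxy : commute (gy ^+ j)%g (gx ^+ k)%g by apply: val_inj; apply: mulrC.
by rewrite /gxy !expgD !mulgA -(mulgA (gx ^+ i)%g) cxy !mulgA.
Qed.

Lemma gxyX i j n : (gxy i j ^+ n)%g = gxy (i * n) (j * n).
Proof.
elim: n => [|n IHn]; first by rewrite !muln0 /gxy !expg0 mulg1.
by rewrite expgS IHn gxyM !mulnS.
Qed.

Lemma cls_natr M n : M %| 333 -> cls M (n%:R)%R = n %% M.
Proof. by move=> M333; rewrite /cls val_Zp_nat // modn_dvdm. Qed.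

Lemma cls9_gxy i j : cls 9 (val (gxy i j)) = 4 ^ j %% 9.
Proof.
rewrite FinRing.val_unitM clsM // !FinRing.val_unitX !clsX //.
by rewrite !val_unitZ333 !cls_natr // exp1n mul1n modn_mod.
Qed.

Lemma cls37_gxy i j : cls 37 (val (gxy i j)) = 2 ^ i %% 37.
Proof.
rewrite FinRing.val_unitM clsM // !FinRing.val_unitX !clsX //.
by rewrite !val_unitZ333 !cls_natr // exp1n muln1 modn_mod.
Qed.

Lemma unitZ333_eq (u v : {unit 'Z_333}) :
  cls 9 (val u) = cls 9 (val v) -> cls 37 (val u) = cls 37 (val v) -> u = v.
Proof.
move=> e9 e37; apply/val_inj/ord_inj.
have lt w : nat_of_ord (val w) < 9 * 37 := ltn_ord (val (w : {unit 'Z_333})).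
rewrite -(modn_small (lt u)) -(modn_small (lt v)); apply/eqP.
by rewrite chinese_remainder //; apply/andP; split; apply/eqP.
Qed.

Lemma gxy_mod i j : gxy i j = gxy (i %% 36) (j %% 3).
Proof.
apply: unitZ333_eq; rewrite ?cls9_gxy ?cls37_gxy.
  rewrite {1}(divn_eq j 3) expnD (mulnC _ 3) expnM -modnMml -modnXm.
  by rewrite exp1n modnMml mul1n.
rewrite {1}(divn_eq i 36) expnD (mulnC _ 36) expnM -modnMml -modnXm.
by rewrite (expn_mod_iter 2 36) // exp1n modnMml mul1n.
Qed.

Lemma gxy_eq1 i j : 36 %| i -> 3 %| j -> gxy i j = 1%g.
Proof.
by move=> /eqP i0 /eqP j0; rewrite gxy_mod i0 j0 /gxy !expg0 mulg1.
Qed.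

Lemma uniq_map_inj (S T : eqType) (f : S -> T) (s : seq S) :
  uniq (map f s) -> {in s &, injective f}.
Proof.
move=> uf p q ps qs e; rewrite -(nth_index p ps) -(nth_index p qs).
congr nth; apply/eqP; rewrite -(nth_uniq (f p) _ _ uf) ?size_map ?index_mem //.
by rewrite !(nth_map p) ?index_mem // !nth_index // e.
Qed.

Lemma expn_mod_inj g M n k l : 1 < M ->
  uniq [seq iter i (fun m => g * m %% M) 1 | i <- iota 0 n] ->
  k < n -> l < n -> g ^ k %% M = g ^ l %% M -> k = l.
Proof.
move=> M1 /uniq_map_inj inj kn ln; rewrite !expn_mod_iter //.
by apply: inj; rewrite mem_iota.
Qed.

Lemma gxy_inj i j k l : gxy i j = gxy k l -> i = k %[mod 36] /\ j = l %[mod 3].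
Proof.
rewrite gxy_mod [RHS]gxy_mod => e; split.
  have := congr1 (fun u => cls 37 (val u)) e; rewrite !cls37_gxy.
  by apply: (@expn_mod_inj _ _ 36); rewrite ?ltn_mod.
have := congr1 (fun u => cls 9 (val u)) e; rewrite !cls9_gxy.
by apply: (@expn_mod_inj _ _ 3); rewrite ?ltn_mod.
Qed.

Lemma mem_U1 (u : {unit 'Z_333}) : (u \in U1) = (cls 3 (val u) == 1).
Proof.
have vred : nat_of_ord (val (red u)) = cls 3 (val u) by apply: val_Zp_nat.
apply/(kerP [morphism of red] (in_setT u))/eqP => [r1|e].
  by rewrite -vred (congr1 (fun v => nat_of_ord (val v)) r1).
by apply/val_inj/ord_inj; apply: (etrans vred).
Qed.

Lemma mem_U1_cls9 (u : {unit 'Z_333}) : (u \in U1) = (cls 9 (val u) %% 3 == 1).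
Proof. by rewrite mem_U1 /cls modn_dvdm. Qed.

Lemma gxy_U1 i j : gxy i j \in U1.
Proof. by rewrite mem_U1_cls9 cls9_gxy modn_dvdm // -modnXm exp1n. Qed.

(** 2 generates the units modulo 37, and the residues 1, 4, 7 modulo 9 are the powers of 4. *)
Lemma U1_gxy u : u \in U1 -> exists i j, u = gxy i j.
Proof.
rewrite mem_U1_cls9 => u3.
have c37 : cls 37 (val u) \in iota 1 36.
  rewrite mem_iota ltn_mod andbT lt0n; apply/negP => u37.
  have : coprime 333 (nat_of_ord (val u)).
    by rewrite -unitZpE // natr_Zp; apply: valP.
  by move=> /(coprime_dvdl (isT : 37 %| 333)); rewrite /coprime (gcdn_idPl u37).
have [i e37] : exists i, cls 37 (val u) = 2 ^ i %% 37.
  have sub : all (mem [seq iter i (fun m => 2 * m %% 37) 1 | i <- iota 0 36])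
    (iota 1 36) by vm_compute.
  have /mapP[i _ ->] := allP sub _ c37.
  by exists i; rewrite expn_mod_iter.
have [j e9] : exists j, cls 9 (val u) = 4 ^ j %% 9.
  have : cls 9 (val u) < 9 by rewrite ltn_mod.
  move: (cls 9 (val u)) u3 => c c3 c9.
  case: c c3 c9 => [|[|[|[|[|[|[|[|[|c]]]]]]]]] // _ _.
  - by exists 0.
  - by exists 1.
  - by exists 2.
by exists i, j; apply: unitZ333_eq; rewrite ?cls9_gxy ?cls37_gxy.
Qed.

(* (d, false, 0) stands for <gx^d>, and (d, true, e) for <gx^d, gx^e gy^2>;
   the exponent 2 makes the membership condition [d %| i + e * j] free of
   subtraction. *)
Definition code := (nat * bool * nat)%type.

Definition code_rel (c : code) (i j : nat) : bool :=
  let: (d, b, e) := c in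
  if b then d %| i + e * j else (d %| i) && (3 %| j).

(** The cube [gx^(3 e)] of [gx^e gy^2] has to lie in [<gx^d>], and [e < d] makes the code unique.
    There are 9 + 21 = 30 codes. *)
Definition codes : seq code :=
  [seq (d, false, 0) | d <- divisors 36] ++
  [seq (d, true, e) | d <- divisors 36, e <- [seq e <- iota 0 d | d %| 3 * e]].

Lemma mem_codes d b e : (d, b, e) \in codes ->
  [/\ d %| 36 & b -> d %| 3 * e].
Proof.
rewrite mem_cat => /orP[/mapP[d' + [-> -> ->]]|].
  by rewrite -dvdn_divisors.
case/allpairsPdep => d' [e' [+ + [-> -> ->]]].
by rewrite -dvdn_divisors // mem_filter => -> /andP[-> _].
Qed.

Lemma code_relD c i j k l : code_rel c i j -> code_rel c k l ->
  code_rel c (i + k) (j + l).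
Proof.
case: c => [[d []] e] /=; first by rewrite mulnDr addnACA; apply: dvdn_add.
by move=> /andP[di dj] /andP[dk dl]; rewrite !dvdn_add.
Qed.

Lemma code_rel_mod c i j : c \in codes ->
  code_rel c (i %% 36) (j %% 3) = code_rel c i j.
Proof.
case: c => [[d b] e] /mem_codes[d36 d3e] /=.
case: b d3e => [/(_ isT) d3e|_]; last first.
  by congr (_ && _); rewrite /dvdn modn_dvdm.
rewrite [in RHS](divn_eq i 36) [in RHS](divn_eq j 3) mulnDr addnACA [RHS]dvdn_addr //.
apply: dvdn_add; first by rewrite dvdn_mull.
by rewrite mulnCA dvdn_mull // mulnC.
Qed.

Definition code_set (c : code) : {set {unit 'Z_333}} :=
  [set u | [exists i : 'I_36, exists j : 'I_3, (u == gxy i j) && code_rel c i j]].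

(** Generation yields a group for every code; for members of [codes] the set is closed already. *)
Definition code_group (c : code) : {group {unit 'Z_333}} := <<code_set c>>%G.

Lemma mem_code_set c i j : c \in codes ->
  (gxy i j \in code_set c) = code_rel c i j.
Proof.
move=> hc; rewrite inE; apply/existsP/idP => [[k /existsP[l /andP[/eqP e r]]]|r].
  have [ei ej] := gxy_inj e.
  by rewrite -code_rel_mod // ei ej code_rel_mod.
exists (Ordinal (ltn_pmod i (isT : 0 < 36))); apply/existsP.
exists (Ordinal (ltn_pmod j (isT : 0 < 3))) => /=.
by rewrite -gxy_mod eqxx code_rel_mod.
Qed.

Lemma code_set_U1 c : code_set c \subset U1.
Proof.
apply/subsetP => u; rewrite inE => /existsP[i /existsP[j /andP[/eqP -> _]]].
exact: gxy_U1.
Qed.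

Lemma code_group_set c : c \in codes -> group_set (code_set c).
Proof.
move=> hc; apply/group_setP; split.
  rewrite -(@gxy_eq1 0 0) // mem_code_set //.
  by case: c hc => [[d []] e] _ /=; rewrite ?muln0 dvdn0.
move=> u v uc vc; have := subsetP (code_set_U1 c) _ uc.
have := subsetP (code_set_U1 c) _ vc.
case/U1_gxy => k [l ev] /U1_gxy[i [j eu]]; move: uc vc; rewrite eu ev gxyM.
by rewrite !mem_code_set //; apply: code_relD.
Qed.

Lemma mem_code_group c i j : c \in codes ->
  (gxy i j \in code_group c) = code_rel c i j.
Proof. by move=> hc; rewrite /= gen_set_id ?mem_code_set ?code_group_set. Qed.

Lemma code_group_U1 c : code_group c \subset U1.
Proof. by rewrite gen_subG code_set_U1. Qed.

Lemma group_eq_gxy (G H : {group {unit 'Z_333}}) : G \subset U1 -> H \subset U1 ->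
  (forall i j, (gxy i j \in G) = (gxy i j \in H)) -> G = H.
Proof.
move=> GU HU e; apply/val_inj/setP => u /=.
have [/U1_gxy[i [j ->]]|uU] := boolP (u \in U1); first exact: e.
by rewrite (contraNF (subsetP GU u)) ?(contraNF (subsetP HU u)).
Qed.

(** The intersection of [H] with [<gx>] is some [<gx^d>], and its index in [H] is 1 or 3. So [H]
    either lies in [<gx>] or contains some [gx^e gy^2]. *)
Lemma subgroup_code (H : {group {unit 'Z_333}}) : H \subset U1 ->
  exists2 c, c \in codes & H = code_group c.
Proof.
move=> HU.
suff [c hc e] : exists2 c, c \in codes & forall i j, (gxy i j \in H) = code_rel c i j.
  exists c => //; apply: group_eq_gxy => // [|i j]; first exact: code_group_U1.
  by rewrite mem_code_group.
have exd : exists n, (0 < n) && (gxy n 0 \in H).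
  by exists 36; rewrite gxy_eq1 // group1.
have [d /andP[d0 dH] dmin] := ex_minnP exd.
have Hd i : (gxy i 0 \in H) = (d %| i).
  have dmH m : gxy (d * m) 0 \in H by have := groupX m dH; rewrite gxyX.
  apply/idP/dvdnP => [iH|[m ->]]; last by rewrite mulnC dmH.
  exists (i %/ d); rewrite [LHS](divn_eq i d).
  have : gxy (i %% d) 0 \in H.
    rewrite -(groupMl _ (dmH (i %/ d))) gxyM addn0 mulnC -divn_eq //.
  have := ltn_pmod i d0; case: (i %% d) (dmin (i %% d)) => [|k]; first by rewrite addn0.
  by move=> dk kd kH; have := dk kH; rewrite leqNgt kd.
have d36 : d %| 36 by rewrite -Hd gxy_eq1 // group1.
have [[e eH]|noe] : (exists e, gxy e 2 \in H) \/ (forall e, gxy e 2 \notin H).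
  have [/existsP[e eH]|/existsPn noe] := boolP [exists e : 'I_36, gxy e 2 \in H].
    by left; exists e.
  right=> e; rewrite gxy_mod.
  exact: (noe (Ordinal (ltn_pmod e (isT : 0 < 36)))).
- have {}eH : gxy (e %% d) 2 \in H.
    have dH' : gxy (e %/ d * d) 0 \in H by rewrite Hd dvdn_mull.
    by rewrite -(groupMl _ dH') gxyM add0n -divn_eq.
  move: (e %% d) (ltn_pmod e d0) eH => {}e ed eH.
  (* Multiplying by [(gx^e gy^2)^j] clears the power of [gy] and leaves [gx^(i + e j)]. *)
  have He i j : (gxy i j \in H) = (d %| i + e * j).
    rewrite -Hd -(groupMr _ (groupX j eH)) gxyX gxyM -mulSn gxy_mod modnMr.
    by rewrite [in RHS]gxy_mod.
  exists (d, true, e) => //; rewrite mem_cat; apply/orP; right.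
  apply/allpairsPdep; exists d, e; split=> //; first by rewrite -dvdn_divisors.
  rewrite mem_filter mem_iota ed andbT.
  by rewrite mulnC -[_ * _]add0n -He gxy_eq1 // group1.
exists (d, false, 0) => [|i j /=].
  by rewrite mem_cat; apply/orP; left; apply/mapP; exists d; rewrite -?dvdn_divisors.
have [j3|j3] := boolP (3 %| j).
  by rewrite andbT gxy_mod (eqP j3) -(Hd i) [in RHS]gxy_mod.
rewrite andbF; apply/negP => ijH.
(* If the exponent of [gy] is 1, squaring makes it 2, which [noe] rules out. *)
have [j1|j2] : j %% 3 = 1 \/ j %% 3 = 2.
  move: j3 (ltn_pmod j (isT : 0 < 3)); rewrite /dvdn.
  by case: (j %% 3) => [|[|[|]]] // _ _; [left|right].
  have := groupX 2 ijH; rewrite gxyX gxy_mod -(modnMml j) j1.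
  exact/negP/noe.
by move: ijH; rewrite gxy_mod j2; apply/negP/noe.
Qed.

(** * Orders and enumeration of the subgroups *)

Definition exps : seq (nat * nat) := [seq (i, j) | i <- iota 0 36, j <- iota 0 3].

Lemma card_code_group c : c \in codes ->
  #|code_group c| = count (fun p => code_rel c p.1 p.2) exps.
Proof.
move=> hc; pose s := [seq gxy p.1 p.2 | p <- exps & code_rel c p.1 p.2].
have mem_exps i j : (i, j) \in exps = (i < 36) && (j < 3).
  apply/allpairsP/andP => [[[k l] [kI lI [-> ->]]]|[i36 j3]].
    by move: kI lI; rewrite !mem_iota.
  by exists (i, j); rewrite !mem_iota.
have us : uniq s.
  rewrite map_inj_in_uniq ?filter_uniq //.
  move=> [i j] [k l]; rewrite !mem_filter !mem_exps /=.
  move=> /and3P[_ i36 j3] /and3P[_ k36 l3] /gxy_inj[].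
  by rewrite !modn_small // => -> ->.
rewrite -size_filter -(size_map (fun p => gxy p.1 p.2)) -/s -(card_uniqP us).
apply: eq_card => u; apply/idP/mapP => [uc|[[i j]]]; last first.
  by rewrite mem_filter => /andP[/= r _] ->; rewrite mem_code_group.
have /U1_gxy[i [j eu]] := subsetP (code_group_U1 c) u uc.
exists (i %% 36, j %% 3); last by rewrite -gxy_mod.
rewrite mem_filter mem_exps !ltn_mod andbT code_rel_mod //.
by rewrite -mem_code_group // -eu.
Qed.

(** The membership tables of the codes on the 108 pairs of [exps] are pairwise distinct, by
    evaluation. *)
Lemma code_group_inj : {in codes &, injective code_group}.
Proof.
move=> c c' hc hc' e.
have : [seq code_rel c p.1 p.2 | p <- exps] = [seq code_rel c' p.1 p.2 | p <- exps].
  by apply: eq_map => p; rewrite -!mem_code_group // e.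
move/(uniq_map_inj (_ : uniq [seq [seq code_rel c p.1 p.2 | p <- exps] | c <- codes])).
by apply=> //; vm_compute.
Qed.

Lemma card_subgroups (P : pred {group {unit 'Z_333}}) (p : pred code) :
  {in codes, forall c, P (code_group c) = p c} ->
  #|[set H in subgroups U1 | P H]| = count p codes.
Proof.
move=> Pp; have us : uniq (map code_group (filter p codes)).
  rewrite map_inj_in_uniq ?filter_uniq //.
  move=> c c'; rewrite !mem_filter => /andP[_ hc] /andP[_ hc'].
  exact: code_group_inj.
rewrite -size_filter -(size_map code_group) -(card_uniqP us).
apply: eq_card => H; rewrite !inE; apply/andP/mapP => [[]|[c]].
  move=> /subgroup_code[c hc ->] PH; exists c => //.
  by rewrite mem_filter hc -Pp ?PH.
by rewrite mem_filter => /andP[pc hc] ->; rewrite code_group_U1 Pp.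
Qed.

(* The elements gx^9, gy and gx^4 gy^j, for j < 3. *)
Definition obstructed (c : code) : bool :=
  [|| code_rel c 9 0, code_rel c 0 1, code_rel c 4 0, code_rel c 4 1
    | code_rel c 4 2].

(** The two listed codes are [<gx^9>], of order 4, and [<gy>], of order 3; they complete the 19
    large subgroups to 21. The subgroup [<gx^18, gy>], of order 6, is obstructed as well but stays
    outside, since exactly 21 are asked for. *)
Definition excluded (c : code) : bool :=
  (9 <= count (fun p => code_rel c p.1 p.2) exps) ||
  (c \in [:: (9, false, 0); (36, true, 0)]).

(** * Subgroups without invariant pairs *)

Lemma no_pair_of_order4 (R : realType) (H : {group {unit 'Z_333}}) :
  gxy 9 0 \in H -> ~ has_invariant_legendre_pair R 333 H.
Proof.
move=> xH /invariant_int_pair[a [b [hab ha hb]]].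
(* Modulo 37, 2^9 = -6, so [gx^9] has order 4 and its cube has residue 6. *)
have := groupX 3 xH; rewrite gxyX => hH.
apply: (int_pair_not6_mod37 hab (ha _ hH) (hb _ hH)).
by rewrite cls37_gxy expn_mod_iter.
Qed.

Lemma no_pair_of_order3 (R : realType) (H : {group {unit 'Z_333}}) :
  gxy 0 1 \in H -> ~ has_invariant_legendre_pair R 333 H.
Proof.
move=> yH /invariant_int_pair[a [b [hab ha hb]]].
apply: (int_pair_not112 hab (ha _ yH) (hb _ yH)).
by rewrite /gxy expg0 mul1g expg1 val_unitZ333.
Qed.

Lemma no_pair_of_order9 (R : realType) (H : {group {unit 'Z_333}}) j :
  gxy 4 j \in H -> ~ has_invariant_legendre_pair R 333 H.
Proof.
move=> hH /invariant_int_pair[a [b [hab ha hb]]].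
apply: (int_pair_not_order9 hab (ha _ hH) (hb _ hH)).
- by rewrite -FinRing.val_unitX gxyX gxy_eq1 // dvdn_mull.
- by rewrite cls37_gxy.
- by apply/eqP; rewrite -mem_U1 gxy_U1.
Qed.

Lemma obstructed_no_pair (R : realType) c : c \in codes -> obstructed c ->
  ~ has_invariant_legendre_pair R 333 (code_group c).
Proof.
move=> hc; rewrite /obstructed -!mem_code_group //.
case/or4P => [||| /orP[]].
- exact: no_pair_of_order4.
- exact: no_pair_of_order3.
all: exact: no_pair_of_order9.
Qed.

Lemma invariant_pair_U1 (R : realType) (H : {group {unit 'Z_333}}) :
  has_invariant_legendre_pair R 333 H -> H \subset U1.
Proof.
case/invariant_int_pair => a [b [hab ha hb]]; apply/subsetP => h hH.
have := int_pair_not2_mod3 hab (ha _ hH) (hb _ hH).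
have hcop : coprime 333 (nat_of_ord (val h)).
  by rewrite -unitZpE // natr_Zp; apply: valP.
have := coprime_dvdl (isT : 3 %| 333) hcop; rewrite mem_U1 /cls -coprime_modr.
move: (ltn_pmod (nat_of_ord (val h)) (isT : 0 < 3)).
by case: (_ %% 3) => [|[|[|]]].
Qed.

Theorem theorem1 (R : realType) :
  (forall H : {group {unit 'Z_333}},
     has_invariant_legendre_pair R 333 H ->
     H \subset U1 /\ #|H| <= 6)
  /\ #|subgroups U1| = 30
  /\ #|[set H in subgroups U1 | 9 <= #|H|]| = 19
  /\ (exists S : {set {group {unit 'Z_333}}},
        [/\ S \subset subgroups U1,
            #|S| = 21,
            [set H in subgroups U1 | 9 <= #|H|] \subset S,
            (forall H : {group {unit 'Z_333}}, H \in S ->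
               ~ has_invariant_legendre_pair R 333 H)
          & #|subgroups U1 :\: S| = 9 /\
            (forall H : {group {unit 'Z_333}},
               H \in subgroups U1 :\: S -> #|H| <= 6)]).
Proof.
have card30 : #|subgroups U1| = 30.
  transitivity #|[set H in subgroups U1 | predT H]|.
    by apply: eq_card => H; rewrite !inE andbT.
  by rewrite (@card_subgroups _ predT) //; vm_compute.
have large c : c \in codes ->
    (9 <= #|code_group c|) = (9 <= count (fun p => code_rel c p.1 p.2) exps).
  by move=> hc; rewrite card_code_group.
have excl_obs c : c \in codes -> excluded c -> obstructed c.
  have /allP chk : all (fun c => excluded c ==> obstructed c) codes by vm_compute.
  by move=> hc; apply/implyP/chk.
have excl_card c : c \in codes -> ~~ excluded c -> #|code_group c| <= 6.
  have /allP chk : all (fun c => ~~ excluded c ==>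
    (count (fun p => code_rel c p.1 p.2) exps <= 6)) codes by vm_compute.
  by move=> hc; rewrite card_code_group //; apply/implyP/chk.
split=> [H hH|].
  have HU := invariant_pair_U1 hH; split=> //.
  have [c hc eH] := subgroup_code HU; rewrite eH; apply: excl_card => //.
  by apply/negP => /(excl_obs c hc)/(obstructed_no_pair hc)-/(_ R); rewrite -eH.
split=> //; split; first by rewrite (card_subgroups large); vm_compute.
(* Quantifying over the finite type of members of [codes] keeps this predicate boolean, so that it
   defines a set. *)
pose inS (H : {group {unit 'Z_333}}) :=
  [exists c : seq_sub codes, (H == code_group (val c)) && excluded (val c)].
have inSE : {in codes, forall c, inS (code_group c) = excluded c}.
  move=> c hc; apply/existsP/idP => [[c' /andP[/eqP e ex]]|ex].
    by rewrite (code_group_inj hc (valP c') e).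
  by exists (SeqSub hc); rewrite eqxx.
exists [set H in subgroups U1 | inS H]; split.
- by apply/subsetP => H; rewrite inE => /andP[].
- by rewrite (card_subgroups inSE); vm_compute.
- apply/subsetP => H; rewrite !inE => /andP[HU].
  have [c hc ->] := subgroup_code HU; rewrite code_group_U1 inSE //= large //.
  by rewrite /excluded => ->.
- move=> H; rewrite !inE => /andP[HU].
  have [c hc ->] := subgroup_code HU; rewrite inSE // => /(excl_obs c hc).
  exact: obstructed_no_pair.
split.
  have -> : subgroups U1 :\: [set H in subgroups U1 | inS H] =
      [set H in subgroups U1 | ~~ inS H].
    by apply/setP => H; rewrite !inE; case: (H \subset U1); rewrite ?andbT ?andbF.
  rewrite (@card_subgroups _ (fun c => ~~ excluded c)); first by vm_compute.
  by move=> c hc; rewrite inSE.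
move=> H; rewrite !inE => /andP[+ HU]; have [c hc ->] := subgroup_code HU.
by rewrite code_group_U1 inSE //=; apply: excl_card.
Qed.
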